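(* Let $\mathbb{P}$ be a probability measure on $\Xi\subseteq\mathbb{R}^p$, $p\neq 2$, for which there is $a>1$ with $A:=\mathbb{E}_{\mathbb{P}}[\exp(\|\xi\|^a)]<\infty$, and consider the stochastic coalitional game $G_{\mathbb{P}}=\{\mathcal{N},\{u_S\}_{S\subseteq\mathcal{N}},\Xi,\mathbb{P}\}$. For each $S\subset\mathcal{N}$ fix a Wasserstein radius $\epsilon_S>0$ and a multi-sample size $K_S\ge 1$, and let coalition $S$ draw its own i.i.d. multi-sample $\xi_{K_S}=(\xi^{(1)},\dots,\xi^{(K_S)})\sim\mathbb{P}^{K_S}$, independently of the samples of all other coalitions. Let $\hat{\mathcal{P}}_{K_S}=\mathbb{B}_{\epsilon_S}(\hat{\mathbb{P}}_{K_S})$ and let $$\beta_S=\begin{cases} c\exp\left(-qK_S\epsilon_S^{\max\{p,2\}}\right), & \epsilon_S\le 1,\\ c\exp\left(-qK_S\epsilon_S^{a}\right), & \epsilon_S>1,\end{cases}$$ where $c,q>0$ are the constants described in the context. Then $$\mathbb{P}^K\left\{\xi_K\in\Xi^K:\ C_{E}(G_{\mathbb{P}})\supseteq C_{\mathrm{DR}}(G_{\hat{\mathcal{P}}_K})\right\}\ \ge\ \beta,\qquad \beta=\prod_{S\subset\mathcal{N}}(1-\beta_S),$$ where $\xi_K=(\xi_{K_S})_{S\subset\mathcal{N}}$, and $\Xi^K$ and $\mathbb{P}^K$ denote the products over $S\subset\mathcal{N}$ of $\Xi^{K_S}$ and $\mathbb{P}^{K_S}$.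
   Context: Agents: $\mathcal{N}=\{1,\dots,N\}$. $S\subset\mathcal{N}$ means a proper subset (a subcoalition); there are $M=2^N-1$ of them. The uncertainty $\xi$ takes values in $\Xi\subseteq\mathbb{R}^p$. Each subcoalition $S$ has a value function $u_S:\Xi\to\mathbb{R}$ (stochastic, through $\xi$); the grand coalition's value $u_{\mathcal{N}}\in\mathbb{R}$ is deterministic. Expected value core: $$C_E(G_{\mathbb{P}})=\Big\{x\in\mathbb{R}^N:\ \sum_{i\in\mathcal{N}}x_i=u_{\mathcal{N}},\ \sum_{i\in S}x_i\ge\mathbb{E}_{\mathbb{P}}[u_S(\xi)]\ \ \forall S\subset\mathcal{N}\Big\}.$$ $\mathcal{M}(\Xi)$ is the set of probability distributions $\mathbb{Q}$ supported on $\Xi$ with $\int_\Xi\|\xi\|\,\mathbb{Q}(d\xi)<\infty$, where $\|\cdot\|$ is a fixed norm on $\mathbb{R}^p$; the true measure satisfies $\mathbb{P}\in\mathcal{M}(\Xi)$. The Wasserstein distance is $d_W(\mathbb{Q}_1,\mathbb{Q}_2)=\inf_\Pi\int_{\Xi^2}\|\xi_1-\xi_2\|\,\Pi(d\xi_1,d\xi_2)$, the infimum being over joint distributions $\Pi$ with marginals $\mathbb{Q}_1,\mathbb{Q}_2$. Given the samples of coalition $S$, $\hat{\mathbb{P}}_{K_S}$ is the empirical distribution placing mass $1/K_S$ on each sample $\xi^{(k_S)}$, $k_S=1,\dots,K_S$, and $\mathbb{B}_{\epsilon_S}(\hat{\mathbb{P}}_{K_S})=\{\mathbb{Q}_S\in\mathcal{M}(\Xi):\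 d_W(\hat{\mathbb{P}}_{K_S},\mathbb{Q}_S)\le\epsilon_S\}$. Distributionally robust (DR) core: $$C_{\mathrm{DR}}(G_{\hat{\mathcal{P}}_K})=\Big\{x\in\mathbb{R}^N:\ \sum_{i\in\mathcal{N}}x_i=u_{\mathcal{N}},\ \sum_{i\in S}x_i\ge\sup_{\mathbb{Q}_S\in\hat{\mathcal{P}}_{K_S}}\mathbb{E}_{\mathbb{Q}_S}[u_S(\xi)]\ \ \forall S\subset\mathcal{N}\Big\}.$$ Standing assumption: for all multi-samples the ambiguity sets are such that the DR core is non-empty. Constants: $c,q>0$ are constants depending only on $a$, $A$ and $p$ for which the (known) Wasserstein measure concentration inequality holds: for every $\epsilon>0$ and every integer $k\ge1$, if $\hat{\mathbb{P}}_k$ is the empirical distribution of $k$ i.i.d. samples from $\mathbb{P}$, then $\mathbb{P}^{k}\{d_W(\mathbb{P},\hat{\mathbb{P}}_k)\le\epsilon\}\ge 1-b(\epsilon,k)$, where $b(\epsilon,k)=c\exp(-qk\epsilon^{\max\{p,2\}})$ if $\epsilon\le1$ and $b(\epsilon,k)=c\exp(-qk\epsilon^{a})$ if $\epsilon>1$.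
   Formalization: The formal theorem additionally assumes β_S ≤ 1 for every subcoalition S; without it an even number of negative factors 1−β_S can make the product β positive and even exceed 1, so the stated bound fails. *)

(* Defs.v *)
From HB Require Import structures.
From mathcomp Require Import all_boot all_order all_algebra.
From mathcomp Require Import all_classical all_reals all_analysis.

Set Implicit Arguments.
Unset Strict Implicit.
Unset Printing Implicit Defensive.
Import Order.TTheory GRing.Theory Num.Theory.
Import numFieldNormedType.Exports.
Local Open Scope classical_set_scope.
Local Open Scope ring_scope.

(* 'M[R]_(m, n) carries the Borel sigma-algebra of its topology. *)
Section borel_matrix.
Context (R : realType) (m n : nat).
Let borel := <<s (@open 'M[R]_(m, n)) >>.

Let borel0 : borel set0.
Proof. exact: sigma_algebra0. Qed.

Let borelC A : borel A -> borel (~` A).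
Proof. exact: sigma_algebraC. Qed.

Let borel_bigcup (F : (set 'M[R]_(m, n))^nat) :
  (forall i, borel (F i)) -> borel (\bigcup_i F i).
Proof. exact: sigma_algebra_bigcup. Qed.

HB.instance Definition _ :=
  @isMeasurable.Build (sigma_display (@open 'M[R]_(m, n)))
    'M[R]_(m, n) borel borel0 borelC borel_bigcup.
End borel_matrix.

(* Dependent finite products, with the sigma-algebra generated by the
   coordinates; an alias is used so as not to put a sigma-algebra on every
   function type. *)
Definition fprodT (I : finType) d (T : I -> measurableType d) : Type :=
  forall i, T i.

Definition fprod_display : measure_display -> measure_display.
Proof. exact. Qed.

Section fprod_measurable.
Context (I : finType) d (T : I -> measurableType d).

HB.instance Definition _ := Pointed.copy (fprodT T) (forall i, T i).

Definition cylinder : set (set (fprodT T)) :=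
  [set C | exists i, exists2 A : set (T i), measurable A & C = [set f | A (f i)]].

Let fprod0 : <<s cylinder >> set0.
Proof. exact: sigma_algebra0. Qed.

Let fprodC A : <<s cylinder >> A -> <<s cylinder >> (~` A).
Proof. exact: sigma_algebraC. Qed.

Let fprod_bigcup (F : (set (fprodT T))^nat) :
  (forall i, <<s cylinder >> (F i)) -> <<s cylinder >> (\bigcup_i F i).
Proof. exact: sigma_algebra_bigcup. Qed.

HB.instance Definition _ :=
  @isMeasurable.Build (fprod_display d) (fprodT T) <<s cylinder >>
    fprod0 fprodC fprod_bigcup.

Lemma measurable_fprod_proj i :
  measurable_fun [set: fprodT T] (fun f : fprodT T => f i).
Proof.
by move=> _ A mA; rewrite setTI; apply: sub_sigma_algebra; exists i; exists A.
Qed.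

Lemma measurable_fun_fprod d' (U : measurableType d') (g : U -> fprodT T) :
  (forall i, measurable_fun [set: U] (fun u => g u i)) ->
  measurable_fun [set: U] g.
Proof.
move=> mg; apply: (@measurability _ _ _ _ _ _ cylinder) => //.
by move=> _ [_ [i [A mA ->]] <-]; exact: mg.
Qed.

Lemma measurable_rectangle (A : forall i, set (T i)) :
  (forall i, measurable (A i)) ->
  measurable [set f : fprodT T | forall i, A i (f i)].
Proof.
move=> mA; rewrite (_ : [set f | _] =
    \bigcap_(i in [set: I]) [set f : fprodT T | A i (f i)]); last first.
  by apply/seteqP; split => [f Af i _|f Af i]; [exact: Af|exact: (Af i Logic.I)].
apply: fin_bigcap_measurable; first exact: finite_finset.
by move=> i _; apply: sub_sigma_algebra; exists i; exists (A i).
Qed.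

Definition fprod_upd i (z : T i * fprodT T) : fprodT T := dfwith z.2 i z.1.

Lemma measurable_fprod_upd i : measurable_fun [set: T i * fprodT T] (@fprod_upd i).
Proof.
apply: measurable_fun_fprod => j; have [ij|ij] := eqVneq i j.
  subst j; rewrite (_ : (fun u => _) = fst)//.
  by apply/funext => z; rewrite /fprod_upd dfwithin.
rewrite (_ : (fun u => _) = (fun f : fprodT T => f j) \o snd); last first.
  by apply/funext => z /=; rewrite /fprod_upd dfwithout.
by apply: measurableT_comp => //; exact: measurable_fprod_proj.
Qed.

HB.instance Definition _ i :=
  isMeasurableFun.Build _ _ _ _ (@fprod_upd i) (@measurable_fprod_upd i).

End fprod_measurable.

(* The product probability: the coordinates are drawn one after the other,
   starting from an arbitrary point all of whose coordinates get overwritten.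
   [fprod_probE] is the characteristic property. *)
Section fprod_prob.
Context (R : realType) (I : finType) d (T : I -> measurableType d).
Variable P : forall i, probability (T i) R.

Fixpoint fprod_prob_seq (s : seq I) : probability (fprodT T) R :=
  if s is i :: s' then
    distribution (P i \x fprod_prob_seq s')%E (@fprod_upd I d T i)
  else \d_(point : fprodT T).

Definition fprod_prob : probability (fprodT T) R := fprod_prob_seq (enum I).

Lemma fprod_prob_seqE (s : seq I) (A : forall i, set (T i)) : uniq s ->
  (forall i, measurable (A i)) -> (forall i, i \notin s -> A i point) ->
  (fprod_prob_seq s [set f : fprodT T | forall i, A i (f i)] =
   \prod_(i <- s) P i (A i))%E.
Proof.
elim: s A => [|i s ih] A /=.
  move=> _ mA Apt; rewrite big_nil diracE mem_set// => i; exact: Apt.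
move=> /andP[i_s us] mA Apt; rewrite big_cons.
pose A' : forall j, set (T j) := dfwith A i setT.
have A'i : A' i = setT by rewrite /A' dfwithin.
have A'j j : i != j -> A' j = A j by move=> ij; rewrite /A' dfwithout.
rewrite /distribution /pushforward /=.
rewrite (_ : _ @^-1` _ = A i `*` [set f : fprodT T | forall j, A' j (f j)]).
  rewrite product_measure1E//; last first.
    apply: measurable_rectangle => j; have [<-|ij] := eqVneq i j.
      by rewrite A'i.
    by rewrite A'j.
  congr (_ * _)%E; apply: etrans (ih A' us _ _) _.
  - by move=> j; have [<-|ij] := eqVneq i j; rewrite ?A'i ?A'j.
  - move=> j js; have [<-|ij] := eqVneq i j; first by rewrite A'i.
    by rewrite A'j//; apply: Apt; rewrite inE negb_or eq_sym ij.
  - apply: eq_big_seq => j js; rewrite A'j//.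
    by apply: contraNneq i_s => ->.
apply/seteqP; split => [[x f] /= Af|[x f] /= [Ax A'f] j].
  split; first by have := Af i; rewrite /fprod_upd dfwithin.
  move=> j; have [<-|ij] := eqVneq i j; first by rewrite A'i.
  by have := Af j; rewrite /fprod_upd A'j// dfwithout.
have [<-|ij] := eqVneq i j; first by rewrite /fprod_upd dfwithin.
by have := A'f j; rewrite /fprod_upd A'j// dfwithout.
Qed.

Lemma fprod_probE (A : forall i, set (T i)) :
  (forall i, measurable (A i)) ->
  (fprod_prob [set f : fprodT T | forall i, A i (f i)] =
   \prod_(i : I) P i (A i))%E.
Proof.
move=> mA; rewrite /fprod_prob fprod_prob_seqE ?enum_uniq//.
  by rewrite big_enum.
by move=> i; rewrite mem_enum.
Qed.

End fprod_prob.

(* Probability of a possibly non-measurable event: the inner measure, which is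
   the measure itself on measurable events. *)
Definition inner_measure d (T : measurableType d) (R : realType)
    (mu : {measure set T -> \bar R}) (A : set T) : \bar R :=
  ereal_sup [set mu B | B in [set B | measurable B /\ B `<=` A]].

Lemma inner_measureE d (T : measurableType d) (R : realType)
    (mu : {measure set T -> \bar R}) (A : set T) :
  measurable A -> inner_measure mu A = mu A.
Proof.
move=> mA; apply/eqP; rewrite eq_le; apply/andP; split.
  by apply: ge_ereal_sup => _ [B [mB BA] <-]; apply: le_measure; rewrite ?inE.
by apply: ereal_sup_ubound; exists A => //; split.
Qed.

(* The empirical distribution; for k = 0 it is the zero measure. *)
Section empirical.
Context (R : realType) d (T : measurableType d) (k : nat) (xi : 'I_k -> T).

Definition empirical (A : set T) : \bar R :=
  ((k%:R^-1)%:E * \sum_(j < k) \d_(xi j) A)%E.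

Let dirac_nat (n : nat) : {measure set T -> \bar R} :=
  if insub n is Some j then \d_(xi j) else mzero.

Let empirical_mscale :
  empirical = mscale ((k%:R : R)^-1)%:nng (msum dirac_nat k).
Proof.
apply/funext => A; rewrite /empirical /mscale /msum /=; congr (_ * _)%E.
by apply: eq_bigr => j _; rewrite /dirac_nat valK.
Qed.

Let empirical0 : empirical set0 = 0%E.
Proof. by rewrite empirical_mscale measure0. Qed.

Let empirical_ge0 A : (0 <= empirical A)%E.
Proof. by rewrite empirical_mscale measure_ge0. Qed.

Let empirical_sigma_additive : semi_sigma_additive empirical.
Proof. by rewrite empirical_mscale; exact: measure_semi_sigma_additive. Qed.

HB.instance Definition _ := isMeasure.Build _ _ _ empirical
  empirical0 empirical_ge0 empirical_sigma_additive.
End empirical.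

Record is_norm (R : realType) (p : nat) (nrm : 'rV[R]_p -> R) : Prop := IsNorm {
  is_norm_eq0 : forall x, nrm x = 0 -> x = 0;
  is_normZ : forall (r : R) x, nrm (r *: x) = `|r| * nrm x;
  is_norm_triangle : forall x y, nrm (x + y) <= nrm x + nrm y }.

Section wasserstein.
Context (R : realType) (p : nat).
Variables (nrm : 'rV[R]_p -> R) (Xi : set 'rV[R]_p).
Local Notation U := 'rV[R]_p.

(* Distributions on Xi are represented by Borel probabilities on R^p that
   give mass 1 to Xi. *)
Definition distributions : set (probability U R) :=
  [set Q | Q Xi = 1%E /\ (\int[Q]_(x in Xi) (nrm x)%:E < +oo)%E].

Definition couplings (mu1 mu2 : {measure set U -> \bar R}) :
    set (probability (U * U)%type R) :=
  [set Pi | forall A, measurable A ->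
     Pi (A `*` setT) = mu1 A /\ Pi (setT `*` A) = mu2 A].

Definition wasserstein (mu1 mu2 : {measure set U -> \bar R}) : \bar R :=
  ereal_inf [set (\int[Pi]_(z in Xi `*` Xi) (nrm (z.1 - z.2))%:E)%E
            | Pi in couplings mu1 mu2].

Definition wasserstein_ball (mu : {measure set U -> \bar R}) (eps : R) :
    set (probability U R) :=
  [set Q | distributions Q /\ (wasserstein mu Q <= eps%:E)%E].
End wasserstein.

(* Subcoalitions: all proper subsets of the set of agents, the empty one
   included. *)
Definition coalition (N : nat) := {S : {set 'I_N} | S \proper finset.setT}.

Section cores.
Context (R : realType) (p N : nat).
Variables (Xi : set 'rV[R]_p) (u : coalition N -> 'rV[R]_p -> R) (uN : R).

(* Only the values of u S on Xi matter.  An undefined expectation is -oo by the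
   convention of the library; this cannot occur for a distribution on Xi with
   finite first moment once every ball has positive radius and the suprema in
   [dr_core] are finite for some sample: mixing a little of its part on
   {u S > 0} into the empirical distribution would give an infinite supremum. *)
Definition expected_value (Q : probability 'rV[R]_p R) (S : coalition N) :
  \bar R := (\int[Q]_(x in Xi) (u S x)%:E)%E.

Definition expected_core (P : probability 'rV[R]_p R) : set 'rV[R]_N :=
  [set x | \sum_i x 0 i = uN /\
     forall S : coalition N,
       (expected_value P S <= (\sum_(i in val S) x 0 i)%:E)%E].

Definition dr_core (amb : coalition N -> set (probability 'rV[R]_p R)) :
    set 'rV[R]_N :=
  [set x | \sum_i x 0 i = uN /\
     forall S : coalition N,
       (ereal_sup [set expected_value Q S | Q in amb S]
        <= (\sum_(i in val S) x 0 i)%:E)%E].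
End cores.

Definition conc_bound (R : realType) (p : nat) (a c q eps : R) (k : nat) : R :=
  if eps <= 1 then c * expR (- (q * k%:R * eps ^+ maxn p 2))
  else c * expR (- (q * k%:R * eps `^ a)).

Definition sample (R : realType) (p k : nat) :=
  fprodT (fun _ : 'I_k => 'rV[R]_p).

Definition sample_law (R : realType) (p : nat) (P : probability 'rV[R]_p R)
    (k : nat) : probability (sample R p k) R :=
  fprod_prob (fun _ : 'I_k => P).

Definition multisample (R : realType) (p N : nat) (K : coalition N -> nat) :=
  fprodT (fun S : coalition N => sample R p (K S)).

Definition multisample_law (R : realType) (p N : nat)
    (P : probability 'rV[R]_p R) (K : coalition N -> nat) :
    probability (multisample R p K) R :=
  fprod_prob (fun S : coalition N => sample_law P (K S)).

(* sample_law P k gives mass 1 to Xi^k, so the first conjunct only restricts the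
   event to the sample space Xi^k. *)
Definition concentration (R : realType) (p : nat) (nrm : 'rV[R]_p -> R)
    (Xi : set 'rV[R]_p) (P : probability 'rV[R]_p R) (a c q : R) : Prop :=
  forall (eps : R) (k : nat), 0 < eps -> (0 < k)%N ->
    ((1 - conc_bound p a c q eps k)%:E <=
     inner_measure (sample_law P k)
       [set xi | (forall j, Xi (xi j)) /\
          (wasserstein nrm Xi P (empirical R xi) <= eps%:E)%E])%E.

Definition empirical_balls (R : realType) (p N : nat) (nrm : 'rV[R]_p -> R)
    (Xi : set 'rV[R]_p) (eps : coalition N -> R) (K : coalition N -> nat)
    (xi : multisample R p K) (S : coalition N) : set (probability 'rV[R]_p R) :=
  wasserstein_ball nrm Xi (empirical R (xi S)) (eps S).

(* Main.v *)
(* If for every coalition S the true law P lies in the Wasserstein ball around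
   the empirical law of S, then P competes in every supremum defining the DR
   core, so the DR core is contained in the expected value core.  By the
   concentration inequality, and since the Wasserstein distance is symmetric
   (exchange the two components of a coupling), this happens for a given S with
   probability at least 1 - beta_S, and the samples of distinct coalitions are
   independent.  Inner measures are attained on measurable subsets, so they are
   super-multiplicative on rectangles of a product probability. *)
Require Import Defs.
From HB Require Import structures.
From mathcomp Require Import all_boot all_order all_algebra.
From mathcomp Require Import all_classical all_reals all_analysis.
Import Order.TTheory GRing.Theory Num.Theory.
Import numFieldNormedType.Exports.
Local Open Scope classical_set_scope.
Local Open Scope ring_scope.

Section integral_pushforward.
Import HBSimple HBNNSimple.

(** The range stays finite, being contained in that of [h]. This transports simple functions in
    either direction along an invertible measurable map. *)
Lemma nnsfun_comp d1 d2 (T1 : measurableType d1) (T2 : measurableType d2)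
    (R : realType) (h : {nnsfun T2 >-> R}) (phi : T1 -> T2) :
  measurable_fun setT phi ->
  {g : {nnsfun T1 >-> R} | g = h \o phi :> (T1 -> R)}.
Proof.
move=> mphi.
have mh : measurable_fun setT (h \o phi) by exact: measurableT_comp.
have fh : finite_set (range (h \o phi)).
  apply: (@sub_finite_set _ _ (range h)); last exact: fimfunP.
  by move=> _ [x _ <-]; exists (phi x).
have h0 x : 0 <= (h \o phi) x by exact: fun_ge0.
pose g : {nnsfun T1 >-> R} := HB.pack (h \o phi)
  (isMeasurableFun.Build _ _ _ _ _ mh) (FiniteImage.Build _ _ _ fh)
  (isNonNegFun.Build _ _ _ h0).
by exists g.
Qed.

(* The simple functions below [f] and below [f \o phi] correspond to each other
   by composition with [phi] and [psi]. *)
Lemma integral_pushforward_can d1 d2 (T1 : measurableType d1)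
    (T2 : measurableType d2) (R : realType) (mu : {measure set T1 -> \bar R})
    (phi : T1 -> T2) (psi : T2 -> T1) (nu : {measure set T2 -> \bar R})
    (D : set T2) (f : T2 -> \bar R) :
  measurable_fun setT phi -> measurable_fun setT psi ->
  cancel phi psi -> cancel psi phi ->
  (forall A, nu A = mu (phi @^-1` A)) ->
  (\int[nu]_(y in D) f y = \int[mu]_(x in phi @^-1` D) f (phi x))%E.
Proof.
move=> mphi mpsi phiK psiK nuE.
(* An arbitrary [k] is taken because the integral is a difference of two such suprema, at the
   positive and negative parts of [f] restricted to [D]. *)
have sup_sintegral (k : T2 -> \bar R) :
    ereal_sup [set sintegral nu h | h in
      [set h : {nnsfun T2 >-> R} | forall y, ((h y)%:E <= k y)%E]] =
    ereal_sup [set sintegral mu h | h in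
      [set h : {nnsfun T1 >-> R} | forall x, ((h x)%:E <= k (phi x))%E]].
  congr ereal_sup; apply/seteqP; split => _ [h /= hk <-].
  - have [g gE] := nnsfun_comp _ _ _ _ _ h phi mphi.
    exists g => [x|]; first by rewrite gE; exact: hk.
    by rewrite /sintegral gE; apply: eq_fsbigr => x _; rewrite nuE.
  - have [g gE] := nnsfun_comp _ _ _ _ _ h psi mpsi.
    exists g => [y|]; first by rewrite gE -[y in k y]psiK; exact: hk.
    rewrite /sintegral gE; apply: eq_fsbigr => x _; rewrite nuE.
    by congr (_ * mu _)%E; apply/seteqP; split => y /=; rewrite phiK.
rewrite /integral !sup_sintegral.
have -> : (fun x => f (phi x)) \_ (phi @^-1` D) = (f \_ D) \o phi.
  apply/funext => x; rewrite /patch /=.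
  by have -> : (x \in phi @^-1` D) = (phi x \in D) by apply/idP/idP; rewrite !inE.
by rewrite funepos_comp funeneg_comp.
Qed.

End integral_pushforward.

Lemma is_normN (R : realType) (p : nat) (nrm : 'rV[R]_p -> R) x :
  is_norm nrm -> nrm (- x) = nrm x.
Proof. by case=> _ nZ _; rewrite -scaleN1r nZ normrN1 mul1r. Qed.

(** The image under the swap of a coupling of [mu2] and [mu1] is a coupling of [mu1] and [mu2] with
    the same cost, since a norm is even. *)
Lemma wasserstein_le_sym (R : realType) (p : nat) (nrm : 'rV[R]_p -> R)
    (Xi : set 'rV[R]_p) (mu1 mu2 : {measure set 'rV[R]_p -> \bar R}) :
  is_norm nrm -> (wasserstein nrm Xi mu1 mu2 <= wasserstein nrm Xi mu2 mu1)%E.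
Proof.
move=> hnrm; apply: le_ereal_inf => _ [Pi Pi_coupling <-].
set U := 'rV[R]_p.
have mswap : measurable_fun setT (@unstable.swap U U) by exact: measurable_swap.
pose swap_mfun : {mfun (U * U)%type >-> (U * U)%type} :=
  HB.pack (@unstable.swap U U) (isMeasurableFun.Build _ _ _ _ _ mswap).
exists (distribution Pi swap_mfun).
  move=> A mA; have [PiA1 PiA2] := Pi_coupling A mA.
  rewrite -PiA1 -PiA2; split; congr (Pi _);
    by apply/seteqP; split => -[x y] /= [].
(* The swap is an involution, so it serves both as the map and as its inverse. *)
rewrite (integral_pushforward_can _ _ _ _ _ Pi swap_mfun swap_mfun) //;
  try exact: unstable.swapK.
rewrite (_ : _ @^-1` _ = Xi `*` Xi); last first.
  by apply/seteqP; split => -[x y] /= [].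
by apply: eq_integral => -[x y] _ /=; rewrite -opprB is_normN.
Qed.

Lemma wassersteinC (R : realType) (p : nat) (nrm : 'rV[R]_p -> R)
    (Xi : set 'rV[R]_p) (mu1 mu2 : {measure set 'rV[R]_p -> \bar R}) :
  is_norm nrm -> wasserstein nrm Xi mu1 mu2 = wasserstein nrm Xi mu2 mu1.
Proof. by move=> hnrm; apply/le_anti; rewrite !wasserstein_le_sym. Qed.

(** The union of a maximizing sequence of measurable subsets of [A] is again such a subset, and its
    measure bounds every term of the sequence. *)
Lemma inner_measure_attained d (T : measurableType d) (R : realType)
    (mu : {measure set T -> \bar R}) (A : set T) :
  exists B, [/\ measurable B, B `<=` A & (inner_measure mu A <= mu B)%E].
Proof.
have /ereal_sup_seq[v vS vlim] :
    [set mu B | B in [set B | measurable B /\ B `<=` A]] != set0.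
  by apply/set0P; exists (mu set0), set0 => //; split => //; exact: sub0set.
have /choice[F FP] n : exists B, [/\ measurable B, B `<=` A & mu B = v n].
  by have [B [mB BA] <-] := vS n; exists B.
have mF n : measurable (F n) by case: (FP n).
exists (\bigcup_n F n); split.
- exact: bigcup_measurable.
- by apply: bigcup_sub => n _; case: (FP n).
- rewrite /inner_measure -(cvg_lim _ vlim)//; apply: lime_le.
    by apply/cvg_ex; eexists; exact: vlim.
  apply: nearW => n; case: (FP n) => _ _ <-.
  apply: le_measure; rewrite ?inE//; first exact: bigcup_measurable.
  exact: bigcup_sup.
Qed.

Lemma lee_prod (R : realDomainType) (I : Type) (s : seq I) (f g : I -> \bar R) :
  (forall i, (0 <= f i)%E) -> (forall i, (f i <= g i)%E) ->
  (\prod_(i <- s) f i <= \prod_(i <- s) g i)%E.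
Proof.
move=> f0 fg; elim: s => [|i s ih]; first by rewrite !big_nil.
by rewrite !big_cons lee_pmul// prode_ge0.
Qed.

(** The rectangle whose sides attain the inner measures of the factors is measurable and contained
    in the given one, and its probability is the product of those of its sides. *)
Lemma inner_measure_fprod_prob (R : realType) (I : finType) d
    (T : I -> measurableType d) (P : forall i, probability (T i) R)
    (A : forall i, set (T i)) :
  (\prod_(i : I) inner_measure (P i) (A i) <=
   inner_measure (fprod_prob P) [set f : fprodT T | forall i, A i (f i)])%E.
Proof.
pose B i := projT1 (cid (inner_measure_attained _ _ _ (P i) (A i))).
have BP i : [/\ measurable (B i), B i `<=` A i &
    (inner_measure (P i) (A i) <= P i (B i))%E].
  exact: projT2 (cid (inner_measure_attained _ _ _ (P i) (A i))).
have mB i : measurable (B i) by case: (BP i).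
apply: (@le_trans _ _ (fprod_prob P [set f : fprodT T | forall i, B i (f i)])).
  rewrite fprod_probE//; apply: lee_prod => i.
    (* The empty set witnesses that an inner measure is nonnegative. *)
    apply: ereal_sup_ubound; exists set0; rewrite ?measure0//.
    by split => //; exact: sub0set.
  by case: (BP i).
apply: ereal_sup_ubound; exists [set f : fprodT T | forall i, B i (f i)] => //.
split; first exact: measurable_rectangle.
by move=> f Bf i; case: (BP i) => _ BA _; exact: BA (Bf i).
Qed.

Lemma dr_core_sub_expected_core (R : realType) (p N : nat) (Xi : set 'rV[R]_p)
    (u : coalition N -> 'rV[R]_p -> R) (uN : R)
    (amb : coalition N -> set (probability 'rV[R]_p R))
    (P : probability 'rV[R]_p R) :
  (forall S, amb S P) -> dr_core Xi u uN amb `<=` expected_core Xi u uN P.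
Proof.
move=> ambP x [sumx lex]; split=> // S; apply: le_trans (lex S).
by apply: ereal_sup_ubound; exists P.
Qed.

Theorem theorem2 (R : realType) (p N : nat) (nrm : 'rV[R]_p -> R)
    (Xi : set 'rV[R]_p) (P : probability 'rV[R]_p R) (a c q : R)
    (u : coalition N -> 'rV[R]_p -> R) (uN : R)
    (eps : coalition N -> R) (K : coalition N -> nat)
    (hp0 : (0 < p)%N) (hp2 : p <> 2%N)
    (hnrm : is_norm nrm) (hXi : measurable Xi)
    (hP : distributions nrm Xi P)
    (ha : 1 < a)
    (hA : (\int[P]_(x in Xi) (expR (nrm x `^ a))%:E < +oo)%E)
    (hu : forall S, measurable_fun Xi (u S))
    (heps : forall S, 0 < eps S) (hK : forall S, (0 < K S)%N)
    (hc : 0 < c) (hq : 0 < q)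
    (hconc : concentration nrm Xi P a c q)
    (hbeta : forall S, conc_bound p a c q (eps S) (K S) <= 1)
    (hDR : forall xi : multisample R p K,
      (forall S j, Xi (xi S j)) ->
      dr_core Xi u uN (empirical_balls nrm Xi eps xi) !=set0) :
  ((\prod_(S : coalition N) (1 - conc_bound p a c q (eps S) (K S)))%:E <=
   inner_measure (multisample_law P K)
     [set xi | (forall S j, Xi (xi S j)) /\
        dr_core Xi u uN (empirical_balls nrm Xi eps xi)
          `<=` expected_core Xi u uN P])%E.
Proof.
pose good S := [set xi : sample R p (K S) | (forall j, Xi (xi j)) /\
  (wasserstein nrm Xi P (empirical R xi) <= (eps S)%:E)%E].
apply: (@le_trans _ _ (inner_measure (multisample_law P K)
  [set xi | forall S, good S (xi S)])).
  apply: le_trans (inner_measure_fprod_prob _ _ _ _ _ good).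
  rewrite -prodEFin; apply: lee_prod => S; last exact: hconc.
  (* Factorwise comparison of the products needs nonnegative lower bounds, that is, each [beta_S] at
     most 1. *)
  by rewrite lee_fin subr_ge0 hbeta.
apply: le_ereal_sup => _ [B [mB Bgood] <-]; exists B => //; split => // xi.
move=> /Bgood xi_good; split=> [S|]; first by case: (xi_good S).
apply: dr_core_sub_expected_core => S; split => //.
(* The concentration inequality measures from [P] to the empirical law, the ball from the empirical
   law to [P]. *)
by rewrite wassersteinC//; case: (xi_good S).
Qed.
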